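(* Let $\mathcal{G}$ and $\mathcal{H}$ be hypergraphs with incidence matrices $B$ and $C$, respectively. If there is a $k$-covering of $\mathcal{H}$ by $\mathcal{G}$, then, after suitable permutations of rows and columns, $B$ is a block matrix $\{D_{i,j}\}$ indexed by the vertices $i$ and hyperedges $j$ of $\mathcal{H}$. Each block $D_{i,j}$ is a permutation matrix of order $k$ if $c_{i,j}=1$, and the zero matrix of order $k$ if $c_{i,j}=0$.
   Context: Hypergraphs have finite vertex sets, and their hyperedges are distinct nonempty subsets of the vertex set. The incidence matrix has rows indexed by vertices and columns by hyperedges, with entry $1$ if the vertex lies in the hyperedge and $0$ otherwise. A covering of $\mathcal{H}$ by $\mathcal{G}$ is a surjective map $\varphi:X(\mathcal{G})\to X(\mathcal{H})$ with the following properties: - for every hyperedge $e$ of $\mathcal{G}$, $\varphi$ is injective on $e$ and $\varphi(e)=\{\varphi(x):x\in e\}$ is a hyperedge of $\mathcal{H}$; - for every vertex $x$, the map $e\mapsto\varphi(e)$ is a bijection from the hyperedges containing $x$ onto the hyperedges of $\mathcal{H}$ containing $\varphi(x)$. It is a $k$-covering if every vertex of $\mathcal{H}$ has exactly $k$ preimages under $\varphi$. *)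

(* Defs.v *)
From HB Require Import structures.
From mathcomp Require Import all_boot all_order all_fingroup all_algebra.

Set Implicit Arguments.
Unset Strict Implicit.
Unset Printing Implicit Defensive.

Import GRing.Theory.
Local Open Scope ring_scope.

Record hypergraph := Hypergraph {
  vertex : finType;
  hyperedges : {set {set vertex}};
  hyperedges_nonempty : set0 \notin hyperedges
}.

Definition incidence (R : nzRingType) (G : hypergraph) :
    'M[R]_(#|vertex G|, #|hyperedges G|) :=
  \matrix_(i, j) ((enum_val i \in (enum_val j : {set vertex G}))%:R).

Definition star (G : hypergraph) (x : vertex G) : {set {set vertex G}} :=
  [set e in hyperedges G | x \in e].

Definition covering (G H : hypergraph) (phi : vertex G -> vertex H) : Prop :=
  [/\ forall y : vertex H, exists x : vertex G, phi x = y,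
      forall e : {set vertex G}, e \in hyperedges G ->
        {in e &, injective phi} /\ phi @: e \in hyperedges H
    & forall x : vertex G,
        {in star x &, injective (fun e : {set vertex G} => phi @: e)} /\
        [set phi @: (e : {set vertex G}) | e in star x] = star (phi x)].

Definition k_covering (k : nat) (G H : hypergraph)
    (phi : vertex G -> vertex H) : Prop :=
  covering phi /\ forall y : vertex H, #|[set x | phi x == y]| = k.

(* Main.v *)
Require Import Defs.
From HB Require Import structures.
From mathcomp Require Import all_boot all_order all_fingroup all_algebra.

Set Implicit Arguments.
Unset Strict Implicit.
Unset Printing Implicit Defensive.

Import GRing.Theory.
Local Open Scope ring_scope.

(** Group the vertices of [G] by their image under the covering [phi], and the
    hyperedges of [G] by their image hyperedge.  If [y] is a vertex of a
    hyperedge [f] of [H], then incidence is a bijection between the vertices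
    over [y] and the hyperedges over [f]: a vertex over [y] lies in exactly one
    hyperedge over [f] since [phi] is bijective on stars, and a hyperedge over
    [f] contains exactly one vertex over [y] since [phi] is injective on it.
    Hence this block is a permutation matrix; as hyperedges are nonempty, every
    hyperedge of [H] also has [k] hyperedges above it, so the blocks are square.
    If [y] is not in [f], nothing over [y] meets anything over [f]. *)

Definition fiber (T U : finType) (q : T -> U) (A : {pred T}) (y : U) :
    {set T} :=
  [set x in A | q x == y].

Lemma card_fiber_in_inj (T U : finType) (q : T -> U) (A : {pred T}) (y : U) :
  {in A &, injective q} -> y \in q @: A -> #|fiber q A y| = 1%N.
Proof.
move=> q_inj /imsetP[x xA ->]; apply/eqP/cards1P; exists x.
apply/setP => x'; rewrite !inE.
by apply/andP/eqP => [[x'A /eqP/q_inj] | ->]; [apply | rewrite eqxx].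
Qed.

Lemma card_sum_fiber (T U : finType) (q : T -> U) (A : {pred T})
    (B : {pred U}) :
  {in A, forall x, q x \in B} ->
  #|A| = (\sum_(j < #|B|) #|fiber q A (enum_val j)|)%N.
Proof.
move=> qB; rewrite -(big_enum_val (fun y => #|fiber q A y|)).
rewrite -sum1_card (partition_big q (mem B)) //=.
by apply: eq_bigr => y _; rewrite -sum1dep_card.
Qed.

Lemma card_sep_imset (T U : finType) (P : pred U) (f : T -> U) (A : {set T}) :
  injective f -> #|[set y in f @: A | P y]| = #|[set x in A | P (f x)]|.
Proof.
move=> f_inj; rewrite -[RHS](card_imset _ f_inj); apply: eq_card => y.
rewrite inE; apply/andP/imsetP => [[/imsetP[x xA ->] Px] | [x]].
  by exists x; rewrite ?inE ?xA.
by rewrite inE => /andP[xA Px] ->; rewrite imset_f.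
Qed.

Definition biunique (T U : finType) (r : T -> U -> bool)
    (A : {set T}) (B : {set U}) : Prop :=
  {in A, forall x, #|[set y in B | r x y]| = 1%N} /\
  {in B, forall y, #|[set x in A | r x y]| = 1%N}.

Lemma card_biunique (T U : finType) (r : T -> U -> bool)
    (A : {set T}) (B : {set U}) :
  biunique r A B -> #|A| = #|B|.
Proof.
move=> [rA rB]; rewrite -!sum1_card -(eq_bigr _ rA) -(eq_bigr _ rB).
under eq_bigr do rewrite -sum1dep_card big_mkcondr.
under [RHS]eq_bigr do rewrite -sum1dep_card big_mkcondr.
exact: exchange_big.
Qed.

Lemma biunique_preim (T U T' U' : finType) (r : T -> U -> bool)
    (f : T' -> T) (g : U' -> U) (A : {set T'}) (B : {set U'}) :
  injective f -> injective g ->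
  biunique r (f @: A) (g @: B) -> biunique (fun a b => r (f a) (g b)) A B.
Proof.
move=> f_inj g_inj [rA rB]; split=> [a aA | b bB].
  by rewrite -card_sep_imset // rA ?imset_f.
by rewrite -(card_sep_imset (r ^~ (g b))) // rB ?imset_f.
Qed.

Lemma is_perm_mx_biunique (R : nzRingType) (n : nat) (r : rel 'I_n) :
  biunique r setT setT -> is_perm_mx (\matrix_(a, b) (r a b)%:R : 'M[R]_n).
Proof.
case=> r_row r_col.
have row_one a : exists b, r a =1 pred1 b.
  have /eqP/cards1P[b /setP rab] := r_row a (in_setT a).
  by exists b => b'; have := rab b'; rewrite !inE.
have [f rf] := fin_all_exists row_one.
have f_inj : injective f.
  move=> a a' faa'; have /eqP/cards1P[a0 /setP ra0] := r_col (f a) (in_setT _).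
  have := ra0 a; have := ra0 a'; rewrite !inE !rf /= faa' eqxx.
  by move=> /esym/eqP -> /esym/eqP.
apply/is_perm_mxP; exists (perm f_inj); apply/matrixP => a b.
by rewrite !mxE permE rf eq_sym.
Qed.

Lemma perm_enum_val (T : finType) (A : {pred T}) (h : 'I_#|A| -> T) :
  injective h -> (forall i, h i \in A) ->
  exists s : 'S_#|A|, forall i, enum_val (s i) = h i.
Proof.
move=> h_inj hA; pose rank_h i := enum_rank_in (hA i) (h i).
have rank_hK i : enum_val (rank_h i) = h i by rewrite enum_rankK_in.
have rank_h_inj : injective rank_h.
  by move=> i j rij; apply: h_inj; rewrite -!rank_hK rij.
by exists (perm rank_h_inj) => i; rewrite permE.
Qed.

Definition block_val (T : finType) (A : {pred T}) (n : nat) (p : 'I_n -> nat)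
    (eqA : #|A| = (\sum_j p j)%N) (s : 'S_#|A|) (j : 'I_n) (a : 'I_(p j)) : T :=
  enum_val (s (cast_ord (esym eqA) (tagnat.Rank j a))).

Arguments block_val {T A n p} eqA s j a.

Lemma block_val_inj (T : finType) (A : {pred T}) (n : nat) (p : 'I_n -> nat)
    (eqA : #|A| = (\sum_j p j)%N) (s : 'S_#|A|) (j : 'I_n) :
  injective (block_val eqA s j).
Proof.
move=> a b /enum_val_inj/perm_inj/cast_ord_inj/(can_inj tagnat.rankK)/eqP.
by rewrite eq_Tagged => /eqP.
Qed.

Lemma perm_block_val (T : finType) (A : {pred T}) (n : nat) (p : 'I_n -> nat)
    (eqA : #|A| = (\sum_j p j)%N) (h : forall j, 'I_(p j) -> T) :
  (forall j a, h j a \in A) -> (forall j, injective (h j)) ->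
  (forall i j a b, h i a = h j b -> i = j) ->
  exists s : 'S_#|A|, forall j, block_val eqA s j =1 h j.
Proof.
move=> hA h_inj h_disjoint.
pose h_sum (u : {j & 'I_(p j)}) : T := h (tag u) (tagged u).
have h_sum_inj : injective h_sum.
  move=> [i a] [j b] hab; have ij : i = j := h_disjoint _ _ _ _ hab.
  by case: j / ij in b hab *; congr existT; apply: h_inj hab.
have h_ord_inj : injective (h_sum \o tagnat.sig \o cast_ord eqA).
  apply: inj_comp (@cast_ord_inj _ _ eqA).
  exact: inj_comp h_sum_inj tagnat.sig_inj.
have [i | s sE] := perm_enum_val h_ord_inj; first exact: hA.
exists s => j a.
by rewrite /block_val sE /= cast_ordKV /tagnat.Rank tagnat.rankK.
Qed.

Lemma block_order_of_fibers (T U : finType) (A : {pred T}) (B : {pred U})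
    (q : T -> U) (p : 'I_#|B| -> nat) :
  {in A, forall x, q x \in B} ->
  (forall j, #|fiber q A (enum_val j)| = p j) ->
  exists (eqA : #|A| = (\sum_j p j)%N) (s : 'S_#|A|),
    forall j, block_val eqA s j @: setT = fiber q A (enum_val j).
Proof.
move=> qB card_fiber.
have eqA : #|A| = (\sum_j p j)%N.
  by rewrite (card_sum_fiber qB); apply: eq_bigr => j _.
pose h j (a : 'I_(p j)) : T := enum_val (cast_ord (esym (card_fiber j)) a).
have h_fiber j a : h j a \in fiber q A (enum_val j) by apply: enum_valP.
have hA j a : h j a \in A by have := h_fiber j a; rewrite inE => /andP[].
have qh j a : q (h j a) = enum_val j.
  by have := h_fiber j a; rewrite inE => /andP[_ /eqP].
have [j a b /enum_val_inj/cast_ord_inj | i j a b hab | s sE] //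
  := perm_block_val eqA hA.
  by apply: enum_val_inj; rewrite -(qh i a) hab qh.
exists eqA, s => j; apply/eqP; rewrite eqEcard card_fiber.
rewrite card_imset ?cardsT ?card_ord ?leqnn ?andbT; last exact: block_val_inj.
by apply/subsetP => _ /imsetP[a _ ->]; rewrite sE.
Qed.

Lemma castmx_mxblock (R : Type) (m n m' n' : nat) (p : 'I_m' -> nat)
    (q : 'I_n' -> nat) (eq_row : m = (\sum_i p i)%N)
    (eq_col : n = (\sum_j q j)%N) (M : 'M[R]_(m, n)) :
  castmx (eq_row, eq_col) M =
    \mxblock_(i, j) \matrix_(a, b)
      M (cast_ord (esym eq_row) (tagnat.Rank i a))
        (cast_ord (esym eq_col) (tagnat.Rank j b)).
Proof.
rewrite -[LHS]submxblockK; apply: eq_mxblock => i j.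
by apply/matrixP => a b; rewrite !mxE castmxE.
Qed.

Lemma incidence_eq1 (R : nzRingType) (G : hypergraph) i j :
  (incidence R G i j == 1) = (enum_val i \in enum_val j).
Proof. by rewrite mxE; case: (_ \in _); rewrite ?eqxx // eq_sym oner_eq0. Qed.

Lemma incidence_eq0 (R : nzRingType) (G : hypergraph) i j :
  (incidence R G i j == 0) = (enum_val i \notin enum_val j).
Proof. by rewrite mxE; case: (_ \in _); rewrite ?eqxx ?oner_eq0. Qed.

Section Coverings.

Variables (G H : hypergraph) (phi : vertex G -> vertex H).

Definition edge_image (e : {set vertex G}) : {set vertex H} := phi @: e.

Definition incidence_block (R : nzRingType) (m n : nat)
    (x : 'I_m -> vertex G) (e : 'I_n -> {set vertex G}) : 'M[R]_(m, n) :=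
  \matrix_(a, b) (x a \in e b)%:R.

Lemma incidence_block_eq0 (R : nzRingType) (m n : nat) (y : vertex H)
    (f : {set vertex H}) (x : 'I_m -> vertex G) (e : 'I_n -> {set vertex G}) :
  x @: setT = fiber phi predT y ->
  e @: setT = fiber edge_image (hyperedges G) f ->
  y \notin f -> incidence_block R x e = 0.
Proof.
move=> x_y e_f yf; apply/matrixP => a b; rewrite !mxE.
have : x a \in fiber phi predT y by rewrite -x_y imset_f.
have : e b \in fiber edge_image (hyperedges G) f by rewrite -e_f imset_f.
rewrite !inE => /andP[_ /eqP eb_f] /eqP xa_y.
case: (boolP (x a \in e b)) => // xe.
by rewrite -xa_y -eb_f imset_f in yf.
Qed.

Hypothesis phi_cov : covering phi.

Lemma biunique_incidence_fibers (y : vertex H) (f : {set vertex H}) :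
  f \in hyperedges H -> y \in f ->
  biunique (fun x (e : {set vertex G}) => x \in e)
    (fiber phi predT y) (fiber edge_image (hyperedges G) f).
Proof.
case: phi_cov => _ phi_edge phi_star fH yf.
split=> [x | e]; rewrite inE => /andP[].
  move=> _ /eqP xy; have [image_inj image_star] := phi_star x.
  rewrite -(card_fiber_in_inj (y := f) image_inj).
    by apply: eq_card => e; rewrite !inE andbAC.
  by rewrite image_star inE fH xy.
move=> eG /eqP ef; have [phi_inj _] := phi_edge e eG.
rewrite -(card_fiber_in_inj (y := y) phi_inj); last by rewrite -ef in yf.
by apply: eq_card => x; rewrite !inE andbC.
Qed.

Lemma card_edge_fiber (k : nat) (f : {set vertex H}) :
  (forall y, #|fiber phi predT y| = k) -> f \in hyperedges H ->
  #|fiber edge_image (hyperedges G) f| = k.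
Proof.
move=> card_vertex_fiber fH.
have /set0Pn[y yf] : f != set0.
  by apply: contraTneq fH => ->; apply: hyperedges_nonempty.
rewrite -(card_vertex_fiber y).
by rewrite (card_biunique (biunique_incidence_fibers fH yf)).
Qed.

Lemma is_perm_mx_incidence_block (R : nzRingType) (n : nat) (y : vertex H)
    (f : {set vertex H}) (x : 'I_n -> vertex G) (e : 'I_n -> {set vertex G}) :
  x @: setT = fiber phi predT y ->
  e @: setT = fiber edge_image (hyperedges G) f ->
  injective x -> injective e -> f \in hyperedges H -> y \in f ->
  is_perm_mx (incidence_block R x e).
Proof.
move=> x_y e_f x_inj e_inj fH yf; apply: is_perm_mx_biunique.
apply: (biunique_preim (r := fun v (d : {set vertex G}) => v \in d)) => //.
by rewrite x_y e_f; apply: biunique_incidence_fibers.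
Qed.

End Coverings.

Theorem theorem9 (R : nzRingType) (G H : hypergraph) (k : nat) :
  (exists phi : vertex G -> vertex H, k_covering k phi) ->
  exists (eq_row : #|vertex G| = (\sum_(i < #|vertex H|) k)%N)
         (eq_col : #|hyperedges G| = (\sum_(j < #|hyperedges H|) k)%N)
         (s : 'S_#|vertex G|) (t : 'S_#|hyperedges G|)
         (D : 'I_#|vertex H| -> 'I_#|hyperedges H| -> 'M[R]_k),
    castmx (eq_row, eq_col) (row_perm s (col_perm t (incidence R G))) =
      \mxblock_(i, j) D i j /\
    (forall (i : 'I_#|vertex H|) (j : 'I_#|hyperedges H|),
       (incidence R H i j = 1 -> is_perm_mx (D i j)) /\
       (incidence R H i j = 0 -> D i j = 0)).
Proof.
case=> phi [phi_cov card_phi].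
have card_vertex_fiber y : #|fiber phi predT y| = k := card_phi y.
have image_edge e : e \in hyperedges G -> edge_image phi e \in hyperedges H.
  by case: phi_cov => _ phi_edge _ /phi_edge[].
have [eq_row [s row_block]] :=
  block_order_of_fibers (B := vertex H) (fun _ _ => isT)
    (fun i => card_vertex_fiber (enum_val i)).
have [eq_col [t col_block]] :=
  block_order_of_fibers image_edge
    (fun j => card_edge_fiber phi_cov card_vertex_fiber (enum_valP j)).
exists eq_row, eq_col, s, t, (fun i j =>
  incidence_block R (block_val eq_row s i) (block_val eq_col t j)).
split=> [|i j].
  rewrite castmx_mxblock; apply: eq_mxblock => i j.
  by apply/matrixP => a b; rewrite !mxE.
split=> /eqP; rewrite ?incidence_eq1 ?incidence_eq0.
  apply: is_perm_mx_incidence_block (row_block i) (col_block j) _ _ _ => //;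
    [exact: block_val_inj | exact: block_val_inj | exact: enum_valP].
exact: incidence_block_eq0 (row_block i) (col_block j).
Qed.
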